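(* There exist constants $0<\varepsilon_0<\varepsilon_1<1$ such that any (possibly adaptive) $(\varepsilon_0,\varepsilon_1)$-tolerant unateness tester for functions $f\colon\{0,1\}^n\to\{0,1\}$ must make $\widetilde{\Omega}(n)$ queries.
   Context: A function $f\colon\{0,1\}^n\to\{0,1\}$ is unate if there is $r\in\{0,1\}^n$ such that $x\mapsto f(x\oplus r)$ is monotone with respect to the coordinatewise partial order (equivalently, $f$ is non-increasing or non-decreasing in each variable). $\mathrm{dist}(f,g)=\Pr_{\boldsymbol x}[f(\boldsymbol x)\ne g(\boldsymbol x)]$ for uniform $\boldsymbol x\in\{0,1\}^n$, and $\mathrm{dist}(f,\mathcal P)=\min_{g\in\mathcal P}\mathrm{dist}(f,g)$. An $(\varepsilon_0,\varepsilon_1)$-tolerant tester for $\mathcal P$, with black-box query access to $f$, accepts with probability at least $2/3$ if $\mathrm{dist}(f,\mathcal P)\le\varepsilon_0$ and rejects with probability at least $2/3$ if $\mathrm{dist}(f,\mathcal P)>\varepsilon_1$. $\widetilde{\Omega}(f)$ means $\Omega(f/\log^c f)$ for an absolute constant $c$. *)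

(* Defs.v *)
From HB Require Import structures.
From mathcomp Require Import all_boot all_order all_algebra.
From mathcomp Require Import all_classical all_reals all_analysis.

Set Implicit Arguments.
Unset Strict Implicit.
Unset Printing Implicit Defensive.

Import Order.TTheory GRing.Theory Num.Theory.

Local Open Scope ring_scope.

Notation cube n := {ffun 'I_n -> bool}.
Notation boolfun n := {ffun {ffun 'I_n -> bool} -> bool}.

Definition cube_xor (n : nat) (x y : cube n) : cube n :=
  [ffun i => x i (+) y i].

Definition cube_le (n : nat) (x y : cube n) : bool :=
  [forall i, x i ==> y i].

Definition monotone (n : nat) (f : boolfun n) : bool :=
  [forall x, forall y, cube_le x y ==> (f x ==> f y)].

Definition unate (n : nat) : pred (boolfun n) :=
  fun f => [exists r : cube n, monotone [ffun x => f (cube_xor x r)]].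

Definition dist (R : realType) (n : nat) (f g : boolfun n) : R :=
  #|[set x : cube n | f x != g x]%SET|%:R / #|{: cube n}|%:R.

(* Since dist f g <= 1, the unit 1 of the iterated minimum does not affect its
   value unless P is empty; see dist_toP. *)
Definition dist_to (R : realType) (n : nat) (f : boolfun n)
    (P : pred (boolfun n)) : R :=
  \big[Num.min/1]_(g : boolfun n | P g) dist R f g.

(* A deterministic adaptive query algorithm: query f at x, then continue with
   the first subtree if f x = false and with the second one if f x = true.
   Leaf true accepts and Leaf false rejects. *)
Inductive dtree (n : nat) : Type :=
| Leaf of bool
| Query of cube n & dtree n & dtree n.

Fixpoint run (n : nat) (t : dtree n) (f : boolfun n) : bool :=
  match t with
  | Leaf b => b
  | Query x t0 t1 => if f x then run t1 f else run t0 f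
  end.

Fixpoint nb_queries (n : nat) (t : dtree n) (f : boolfun n) : nat :=
  match t with
  | Leaf _ => 0
  | Query x t0 t1 => (if f x then nb_queries t1 f else nb_queries t0 f).+1
  end.

(* A randomized adaptive query algorithm draws its internal coins from an
   arbitrary probability space and then runs a deterministic one. *)
Record ralg (R : realType) (n : nat) := RAlg {
  coin_disp : measure_display;
  coin : measurableType coin_disp;
  coin_prob : probability coin R;
  ralg_tree : coin -> dtree n;
  ralg_measurable : forall f : boolfun n,
    measurable [set w : coin | run (ralg_tree w) f = true]%classic
}.

Arguments coin_prob {R n} _.
Arguments ralg_tree {R n} _ _.
Arguments ralg_measurable {R n} _ _.

Definition accept_prob (R : realType) (n : nat) (A : ralg R n)
    (f : boolfun n) : \bar R :=
  coin_prob A [set w | run (ralg_tree A w) f = true]%classic.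

Definition reject_prob (R : realType) (n : nat) (A : ralg R n)
    (f : boolfun n) : \bar R :=
  coin_prob A [set w | run (ralg_tree A w) f = false]%classic.

Definition makes_at_most (R : realType) (n : nat) (A : ralg R n) (q : nat) :
    Prop :=
  forall (w : coin A) (f : boolfun n), (nb_queries (ralg_tree A w) f <= q)%N.

Definition tolerant_tester (R : realType) (n : nat) (P : pred (boolfun n))
    (eps0 eps1 : R) (A : ralg R n) : Prop :=
  forall f : boolfun n,
    (dist_to R f P <= eps0 -> ((2 / 3)%:E <= accept_prob A f)%E) /\
    (eps1 < dist_to R f P -> ((2 / 3)%:E <= reject_prob A f)%E).

Lemma dist_le1 (R : realType) (n : nat) (f g : boolfun n) : dist R f g <= 1.
Proof.
rewrite /dist ler_pdivrMr ?mul1r ?ler_nat ?max_card // ltr0n.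
by apply/card_gt0P; exists [ffun => false].
Qed.

Lemma dist_toP (R : realType) (n : nat) (f : boolfun n) (P : pred (boolfun n))
    (g0 : boolfun n) : P g0 ->
  (exists2 g, P g & dist_to R f P = dist R f g) /\
  (forall g, P g -> dist_to R f P <= dist R f g).
Proof.
move=> Pg0; split; last by move=> g Pg; exact: bigmin_le_cond.
have [|g Pg e] := @eq_bigmin _ _ _ 1 g0 P (dist R f) Pg0; last by exists g.
by move=> g _; exact: dist_le1.
Qed.

Lemma unate_cst (n : nat) (b : bool) : unate [ffun _ : cube n => b].
Proof.
apply/existsP; exists [ffun => false]; apply/forallP => x; apply/forallP => y.
by rewrite !ffunE implybb implybT.
Qed.

(* Main.v *)
(** A hidden sign vector [rho] on [4 * n1] variables is encoded by [64 * n1] parities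
of four signs each, read off a fixed bipartite graph. If every small set of parities
has more than twice as many neighbours as elements, it has a neighbour seen only once,
so the parities of a uniform [rho] are [q]-wise independent and no adaptive algorithm
making [q] queries tells them from uniform bits [b]. A random graph has this property
for [q] linear in [n1].

Each parity bit [b t] yields eight cells, one for each sign pattern of parity [b t];
the function of a cell is the AND of its four variables with these signs. A tribes
multiplexer selects a cell: the function is [0] if no tribe is satisfied, [1] if at
least two are, and the function of cell [k] if [k] is the only satisfied tribe. It is
monotone in the tribe variables, so the distance to functions that are unate with
orientation [rho] is the number of cells whose sign pattern differs from [rho], times
a constant mass. A parity that agrees with [rho] has seven such cells and one that
disagrees has eight. For parities of some [rho] the total is [7 * 64 * n1]; for uniform
bits, whp every [rho] agrees with less than three quarters of them. The tribes have
logarithmic width, hence [n] is of order [n1 * log n1]. *)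

Require Import Defs.
From mathcomp Require Import all_boot all_order all_algebra.
From mathcomp Require Import all_classical all_reals all_analysis.
From mathcomp Require Import measurable_realfun zify ring lra.

Set Implicit Arguments.
Unset Strict Implicit.

Import Order.TTheory GRing.Theory Num.Theory.

Local Open Scope set_scope.
Local Open Scope ring_scope.

(** * Expanding graphs *)

(** The falling factorial of 2n of length n has all factors at least n, and it is n! times a central
    binomial coefficient, which is at most 4^n. *)
Lemma leq_expn_fact (n : nat) : (n ^ n <= 4 ^ n * n`!)%N.
Proof.
have h1 : (n ^ n <= (n + n) ^_ n)%N.
  rewrite ffact_prod -[X in (n ^ X)%N]card_ord -prod_nat_const.
  by apply: leq_prod => i _; have := ltn_ord i; lia.
apply: leq_trans h1 _; rewrite -bin_ffact leq_mul2r; apply/orP; right.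
have -> : (4 ^ n = (1 + 1) ^ (n + n))%N by rewrite expnD -expnMn.
rewrite expnDn; have hn : (n < (n + n).+1)%N by lia.
by rewrite (bigD1 (Ordinal hn)) //= !exp1n !muln1 leq_addr.
Qed.

(** Division-free form of the estimate C(a, b) <= (4a/b)^b. *)
Lemma leq_bin_expn (a b : nat) : ('C(a, b) * b ^ b <= (4 * a) ^ b)%N.
Proof.
apply: (@leq_trans ('C(a, b) * (4 ^ b * b`!))).
  by rewrite leq_mul2l leq_expn_fact orbT.
rewrite mulnCA bin_ffact expnMn leq_mul2l; apply/orP; right.
rewrite ffact_prod -[X in (a ^ X)%N]card_ord -prod_nat_const.
by apply: leq_prod => i _; lia.
Qed.

(** The sum is at most T (1 - 2^-q); the induction proves this sharper bound, cleared of
    denominators. *)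
Lemma geometric_sum_ltn (B : nat -> nat) (T q : nat) : (0 < T)%N ->
  (forall m, 0 < m <= q -> B m * 2 ^ m <= T)%N ->
  (\sum_(1 <= m < q.+1) B m < T)%N.
Proof.
move=> T0 HB.
have : (2 ^ q * (\sum_(1 <= m < q.+1) B m) + T <= 2 ^ q * T)%N.
  elim: q HB => [|q IH] HB; first by rewrite big_geq // muln0 mul1n.
  rewrite big_nat_recr //= expnS.
  have h1 := IH (fun m hm => HB m ltac:(lia)).
  have h2 := HB q.+1 ltac:(lia).
  by rewrite expnS in h2; nia.
move=> h; rewrite ltnNge; apply/negP => h'.
have : (2 ^ q * T <= 2 ^ q * (\sum_(1 <= m < q.+1) B m))%N by rewrite leq_mul2l h' orbT.
by lia.
Qed.

Lemma superset_card (T : finType) (A : {set T}) (k : nat) :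
  (#|A| <= k <= #|T|)%N -> exists2 B : {set T}, A \subset B & #|B| = k.
Proof.
move=> /andP[Ak kT].
have /card_geqP[s [us ss sA]] : (k - #|A| <= #|~: A|)%N.
  by have := cardsC A; lia.
exists (A :|: [set x in s]); first exact: finset.subsetUl.
have dis : A :&: [set x in s] = finset.set0.
  apply/setP => x; rewrite !inE; apply/negP => /andP[xA /sA].
  by rewrite inE xA.
by rewrite cardsU dis cards0 cardsE (card_uniqP us) ss; lia.
Qed.

(** [v] encodes the bipartite graph joining [t] to [(l, v (t, l))] for each [l]. The right side has
    four blocks of [n] vertices, so the four neighbours of [t] are always distinct. *)
Definition nbh (M n : nat) (v : {ffun 'I_M * 'I_4 -> 'I_n}) (S : {set 'I_M}) :
  {set 'I_4 * 'I_n} := [set (x.2, v x) | x in [set x : 'I_M * 'I_4 | x.1 \in S]].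

(** Each of the 4m edges leaving [S] has at most [#|U|] possible endpoints; the other edges are
    free. *)
Lemma card_confined (M n m : nat) (S : {set 'I_M}) (U : {set 'I_4 * 'I_n}) :
  #|S| = m -> #|U| = (2 * m)%N ->
  (#|[set v : {ffun 'I_M * 'I_4 -> 'I_n} | nbh v S \subset U]|
    <= (2 * m) ^ (4 * m) * n ^ (4 * (M - m)))%N.
Proof.
move=> hS hU.
pose F (x : 'I_M * 'I_4) := [set u : 'I_n | (x.1 \in S) ==> ((x.2, u) \in U)].
have sub : [set v : {ffun 'I_M * 'I_4 -> 'I_n} | nbh v S \subset U] \subset
   family F.
  apply/fintype.subsetP => v; rewrite inE => /fintype.subsetP h; apply/familyP => x.
  rewrite inE; apply/implyP => xS; apply: h; apply/imsetP.
  by exists x; rewrite ?inE.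
apply: leq_trans (subset_leq_card sub) _.
rewrite card_family foldrE big_map big_enum /=.
rewrite (bigID (fun x : 'I_M * 'I_4 => x.1 \in S)) /=.
have cS : #|[set x : 'I_M * 'I_4 | x.1 \in S]| = (4 * m)%N.
  have -> : [set x : 'I_M * 'I_4 | x.1 \in S] = finset.setX S [set: 'I_4].
    by apply/setP => x; rewrite !inE andbT.
  by rewrite cardsX cardsT card_ord hS mulnC.
apply: leq_mul.
- rewrite -cS -prod_nat_const; under [leqRHS]eq_bigl do rewrite inE.
  apply: leq_prod => x xS; rewrite -hU.
  have inj : injective (fun u : 'I_n => (x.2, u)) by move=> u u' [].
  rewrite -(card_imset _ inj); apply: subset_leq_card;
    apply/fintype.subsetP => y /imsetP[u].
  by rewrite inE xS /= => hu ->.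
- have -> : (4 * (M - m))%N = #|[set x : 'I_M * 'I_4 | x.1 \notin S]|.
    have := cardsC [set x : 'I_M * 'I_4 | x.1 \in S].
    rewrite cS card_prod !card_ord.
    have -> : ~: [set x : 'I_M * 'I_4 | x.1 \in S] = [set x : 'I_M * 'I_4 | x.1 \notin S].
      by apply/setP => x; rewrite !inE.
    lia.
  rewrite -prod_nat_const; under [leqRHS]eq_bigl do rewrite inE.
  by apply: leq_prod => x xS; rewrite -[leqRHS]card_ord max_card.
Qed.

(** After [leq_bin_expn] the powers of m and 2m from the two binomials cancel, and both sides become
    m-th powers. Their bases are 256n * (16n)^2 * 4m * 2 = 2^19 m n^3 and n^4, whence the constant
    2^19. *)
Lemma expander_bound (n m : nat) : (2 ^ 19 * m <= n)%N ->
  ('C(64 * n, m) * 'C(4 * n, 2 * m) * (2 * m) ^ (4 * m) * 2 ^ m <= n ^ (4 * m))%N.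
Proof.
move=> hm.
have h1 := leq_bin_expn (64 * n) m.
have h2 := leq_bin_expn (4 * n) (2 * m).
set C1 := 'C(_, m) in h1 *; set C2 := 'C(_, _) in h2 *.
have -> : ((2 * m) ^ (4 * m) = (2 * m) ^ (2 * m) * m ^ m * (4 * m) ^ m)%N.
  have -> : (4 * m = 2 * m + 2 * m)%N by lia.
  rewrite expnD -mulnA; congr muln.
  by rewrite -expnMn [(2 * m)%N as X in (_ ^ X)%N]mulnC expnM expnAC; congr expn; lia.
apply: (@leq_trans (((4 * (64 * n)) ^ m * (4 * (4 * n)) ^ (2 * m))
    * ((4 * m) ^ m * 2 ^ m))%N).
  apply: leq_trans (leq_mul (leq_mul h1 h2) (leqnn _)).
  by apply: eq_leq; ring.
rewrite !(expnM _ 2 m) !(expnM _ 4 m) -!expnMn.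
case: m hm {h1 h2 C1 C2} => // m hm; rewrite leq_exp2r //.
apply: (@leq_trans (n ^ 3 * (2 ^ 19 * m.+1))%N); first by apply: eq_leq; ring.
by rewrite [leqRHS]expnSr leq_mul2l hm orbT.
Qed.

(** Union bound: if a set of size m fails to expand, its neighbourhood lies in some [U] of exactly
    2m vertices. The graphs that are bad for size m form a fraction of at most 2^-m, and these
    fractions sum to less than 1. *)
Lemma expander_exists (n : nat) : (0 < n)%N ->
  exists v : {ffun 'I_(64 * n) * 'I_4 -> 'I_n}, forall S : {set 'I_(64 * n)},
    (0 < #|S|)%N -> (2 ^ 19 * #|S| <= n)%N -> (2 * #|S| < #|nbh v S|)%N.
Proof.
move=> n0; set M := (64 * n)%N.
pose T := {ffun 'I_M * 'I_4 -> 'I_n}.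
pose q := (n %/ 2 ^ 19)%N.
pose bad (m : nat) : {set T} :=
  \bigcup_(p : {set 'I_M} * {set 'I_4 * 'I_n} | (#|p.1| == m) && (#|p.2| == 2 * m)%N)
    [set v : T | nbh v p.1 \subset p.2].
pose B m := ('C(M, m) * 'C(4 * n, 2 * m) *
  ((2 * m) ^ (4 * m) * n ^ (4 * (M - m))))%N.
have cbad m : (#|bad m| <= B m)%N.
  apply: (@leq_trans (\sum_(p : {set 'I_M} * {set 'I_4 * 'I_n} |
      (#|p.1| == m) && (#|p.2| == 2 * m)%N) ((2 * m) ^ (4 * m) * n ^ (4 * (M - m))))).
    rewrite /bad; elim/big_rec2: _ => [|p y1 y2 /andP[/eqP h1 /eqP h2] IH];
      first by rewrite cards0.
    by rewrite (leq_trans (leq_card_setU _ _).1) // leq_add // card_confined.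
  rewrite sum_nat_const /B leq_mul2r; apply/orP; right; apply: eq_leq.
  have ->
      : #|[pred p : {set 'I_M} * {set 'I_4 * 'I_n} | (#|p.1| == m) && (#|p.2| == 2 * m)%N]|
     = #|finset.setX [set A : {set 'I_M} | #|A| == m]
         [set A : {set 'I_4 * 'I_n} | #|A| == (2 * m)%N]|.
    by apply: eq_card => p; rewrite !inE.
  by rewrite cardsX !card_draws card_prod !card_ord.
have T0 : #|{: T}| = (n ^ (4 * M))%N.
  by rewrite card_ffun card_prod !card_ord mulnC.
have lt : (\sum_(1 <= m < q.+1) B m < #|{: T}|)%N.
  apply: geometric_sum_ltn => [|m /andP[m0 mq]]; first by rewrite T0 expn_gt0 n0.
  have hm : (2 ^ 19 * m <= n)%N.
    by apply: leq_trans (leq_divM n (2 ^ 19)); rewrite mulnC leq_mul2r mq.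
  have mM : (m <= M)%N 
    by rewrite /M (leq_trans (leq_trans _ hm)) ?leq_pmull ?expn_gt0.
  have -> : #|{: T}| = (n ^ (4 * m) * n ^ (4 * (M - m)))%N.
    by rewrite T0 -expnD; congr expn; lia.
  by rewrite /B mulnA mulnAC leq_mul2r expander_bound ?orbT.
have [v vbad] : exists v : T, v \notin \bigcup_(m < q.+1 | (0 < m)%N) bad m.
  apply/existsP; apply: contraLR lt; rewrite negb_exists => /forallP h.
  rewrite -leqNgt.
  have -> : #|{: T}| = #|\bigcup_(m < q.+1 | (0 < m)%N) bad m|.
    by rewrite -cardsT; apply: eq_card => v; rewrite inE; have := h v;
      rewrite negbK => ->.
  apply: (@leq_trans (\sum_(m < q.+1 | (0 < m)%N) B m)).
    elim/big_rec2: _ => [|i y1 y2 _ IH]; first by rewrite cards0.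
    by rewrite (leq_trans (leq_card_setU _ _).1) // leq_add.
  rewrite -(big_mkord (fun m => 0 < m)%N B) big_ltn_cond //= big_mkcond.
  by apply: leq_sum => m _; case: ifP.
exists v => S S0 hS; rewrite ltnNge; apply/negP => le.
move/negP: vbad; apply; apply/bigcupP.
have Sq : (#|S| < q.+1)%N by rewrite ltnS /q leq_divRL // mulnC.
exists (Ordinal Sq) => //=.
have [|U sub cU] := @superset_card _ (nbh v S) (2 * #|S|).
  rewrite le card_prod !card_ord /=.
  rewrite (leq_trans (leq_trans _ hS)) ?leq_pmull //.
  by rewrite leq_mul2r -[X in (X <= _)%N]expn1 leq_exp2l ?orbT.
by apply/bigcupP; exists (S, U); rewrite /= ?eqxx ?cU ?eqxx // inE.
Qed.

(** Only 4|S| edges leave [S]; if each neighbour received two of them, there would be at most 2|S|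
    neighbours. *)
Lemma unique_neighbour (M n : nat) (v : {ffun 'I_M * 'I_4 -> 'I_n}) (S : {set 'I_M}) :
  (2 * #|S| < #|nbh v S|)%N ->
  exists l t, t \in S /\ forall t', t' \in S -> (v (t', l) == v (t, l)) = (t' == t).
Proof.
move=> h.
pose E := [set x : 'I_M * 'I_4 | x.1 \in S].
have cE : #|E| = (4 * #|S|)%N.
  have -> : E = finset.setX S [set: 'I_4] by apply/setP => x; rewrite !inE andbT.
  by rewrite cardsX cardsT card_ord mulnC.
pose g (x : 'I_M * 'I_4) := (x.2, v x).
pose fib (u : 'I_4 * 'I_n) := [set x in E | g x == u].
have sE : #|E| = (\sum_(u in nbh v S) #|fib u|)%N.
  rewrite -sum1_card (partition_big_imset g) /=; apply: eq_bigr => u _.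
  by rewrite -sum1_card; apply: eq_bigl => x; rewrite !inE.
have [u uN /eqP u1] : exists2 u, u \in nbh v S & #|fib u| == 1%N.
  apply/exists_inP; rewrite -[X in is_true X]negbK negb_exists_in;
    apply/negP => /forall_inP hn.
  have : (2 * #|nbh v S| <= #|E|)%N.
    rewrite sE mulnC -sum_nat_const; apply: leq_sum => u uN.
    have : (0 < #|fib u|)%N.
      by case/imsetP: uN => x xE ->; apply/card_gt0P; exists x; rewrite inE xE eqxx.
    by have := hn u uN; lia.
  by rewrite cE; lia.
move/eqP/cards1P : u1 => [[t l] ft].
have : (t, l) \in fib u by rewrite ft inE.
rewrite !inE /= => /andP[tS /eqP gu].
exists l, t; split => // t' t'S.
have : ((t', l) \in fib u) = (t' == t) by rewrite ft inE xpair_eqE eqxx andbT.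
by rewrite !inE /= t'S /= -gu /g /= xpair_eqE eqxx.
Qed.

(** * Query algorithms on q-wise independent bits *)

(** The query bound holds along runs only: a tree may have deeper branches that no [f] reaches.
    Truncation at depth [d] permits an induction on the budget; the default [false] is never
    returned within the query bound. *)
Fixpoint run_upto (n : nat) (d : nat) (t : dtree n) (f : boolfun n) : bool :=
  match d, t with
  | _, Leaf b => b
  | 0, Query _ _ _ => false
  | d'.+1, Query x t0 t1 => if f x then run_upto d' t1 f else run_upto d' t0 f
  end.

Lemma run_uptoE (n d : nat) (t : dtree n) (f : boolfun n) :
  (nb_queries t f <= d)%N -> run_upto d t f = run t f.
Proof.
elim: d t => [|d IH] [b|x t0 t1] //=.
by case: (f x) => h; apply: IH.
Qed.

Definition character (R : realType) (M : nat) (S : {set 'I_M}) (b : cube M) : R :=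
  \prod_(t in S) (-1) ^+ b t.

Lemma character0 (R : realType) (M : nat) (b : cube M) : character R finset.set0 b = 1.
Proof. by rewrite /character big_set0. Qed.

Lemma character_toggle (R : realType) (M : nat) (S : {set 'I_M}) (t : 'I_M) :
  exists2 S' : {set 'I_M}, (#|S'| <= #|S|.+1)%N &
    forall b, character R S b * (-1) ^+ b t = character R S' b.
Proof.
case: (boolP (t \in S)) => tS.
  exists (S :\ t); first by rewrite leqW ?subset_leq_card ?subD1set.
  move=> b;
    rewrite /character [in LHS](big_setD1 t) //= mulrC mulrA -expr2 sqrr_sign mul1r //.
exists (t |: S); first by rewrite cardsU1 tS.
by move=> b; rewrite /character [in RHS](big_setU1 t) //= mulrC.
Qed.

(* [lab w] for uniform [w] has any [q] of its bits jointly uniform: all its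
   nontrivial characters of degree at most [q] have mean zero. *)
Definition fooling (R : realType) (M q : nat) (W : finType) (lab : W -> cube M) : Prop :=
  forall S : {set 'I_M}, (0 < #|S| <= q)%N -> \sum_w character R S (lab w) = 0.

(** Every query to [F b], adaptive or not, reveals at most one bit of the label [b]. *)
Definition one_bit (M n : nat) (F : cube M -> boolfun n) : Prop :=
  forall x, exists t, forall b b' : cube M, b t = b' t -> F b x = F b' x.

Definition mean (R : realType) (W : finType) (G : W -> R) : R := (\sum_w G w) / #|W|%:R.

Lemma meanD (R : realType) (W : finType) (G H : W -> R) :
  mean (fun w => G w + H w) = mean G + mean H.
Proof. by rewrite /mean big_split mulrDl. Qed.

Lemma meanZ (R : realType) (W : finType) (a : R) (G : W -> R) :
  mean (fun w => a * G w) = a * mean G.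
Proof. by rewrite /mean -mulr_sumr mulrA. Qed.

Lemma eq_mean (R : realType) (W : finType) (G H : W -> R) :
  (forall w, G w = H w) -> mean G = mean H.
Proof. by move=> h; rewrite /mean; congr (_ / _); apply: eq_bigr. Qed.

Lemma mean_character (R : realType) (M q : nat) (W : finType) (lab : W -> cube M)
    (S : {set 'I_M}) : (0 < #|W|)%N -> fooling R q lab -> (#|S| <= q)%N ->
  mean (fun w => character R S (lab w)) = (#|S| == 0)%:R.
Proof.
move=> W0 foolW Sq; case: (posnP #|S|) => [S0|S0].
  rewrite (cards0_eq S0) /=; under eq_mean do rewrite character0.
  by rewrite /mean sumr_const divff // pnatr_eq0 -lt0n.
by rewrite /mean foolW ?S0 //= mul0r.
Qed.

(** The output expands into characters of degree at most [q], whose means agree on both sides. The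
    factor indexed by [S] collects the signs of the bits read so far: a query enlarges [S] by at
    most one and lowers [d] by one. *)
Lemma fooling_run (R : realType) (M n q : nat) (F : cube M -> boolfun n)
    (W V : finType) (lW : W -> cube M) (lV : V -> cube M) :
  (0 < #|W|)%N -> (0 < #|V|)%N -> one_bit F ->
  fooling R q lW -> fooling R q lV ->
  forall (t : dtree n) (d : nat) (S : {set 'I_M}), (#|S| + d <= q)%N ->
  mean (fun w => character R S (lW w) * (run_upto d t (F (lW w)))%:R) =
  mean (fun w => character R S (lV w) * (run_upto d t (F (lV w)))%:R).
Proof.
move=> W0 V0 F1 fW fV.
have leaf (b : R) (S : {set 'I_M}) : (#|S| <= q)%N ->
  mean (fun w => character R S (lW w) * b) =
  mean (fun w => character R S (lV w) * b).
  move=> Sq; under eq_mean do rewrite mulrC.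
  under [RHS]eq_mean do rewrite mulrC.
  by rewrite !meanZ !(@mean_character _ _ q).
move=> t d; elim: d t => [|d IH] [b|x t0 t1] S Sq /=; try by apply: leaf; lia.
have [t Ft] := F1 x.
have [S' S'S hS'] := character_toggle R S t.
pose y (a : bool) : bool := F [ffun => a] x.
have yE b : F b x = y (b t) by apply: Ft; rewrite ffunE.
(* Fourier expansion in the queried bit: y(a) = (y(0) + y(1))/2 + (y(0) - y(1))/2 * (-1)^a, and
   likewise for its negation. *)
have key (W' : finType) (l : W' -> cube M) :
  mean (fun w => character R S (l w) *
     (if F (l w) x then run_upto d t1 (F (l w)) else run_upto d t0 (F (l w)))%:R) =
  ((y false)%:R + (y true)%:R) / 2 *
    mean (fun w => character R S (l w) * (run_upto d t1 (F (l w)))%:R)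
  + ((y false)%:R - (y true)%:R) / 2 *
    mean (fun w => character R S' (l w) * (run_upto d t1 (F (l w)))%:R)
  + ((~~ y false)%:R + (~~ y true)%:R) / 2 *
    mean (fun w => character R S (l w) * (run_upto d t0 (F (l w)))%:R)
  + ((~~ y false)%:R - (~~ y true)%:R) / 2 *
    mean (fun w => character R S' (l w) * (run_upto d t0 (F (l w)))%:R).
  rewrite -!meanZ -!meanD; apply: eq_mean => w; rewrite -!hS' yE.
  by case: (l w t); case: (y true); case: (y false); rewrite /= ?expr0 ?expr1; field.
by rewrite !key !IH //; lia.
Qed.

(** * Independent events in the cube *)

Definition prob (R : realType) (n : nat) (A : {set cube n}) : R :=
  #|A|%:R / #|{: cube n}|%:R.

Definition depends_on (n : nat) (J : {set 'I_n}) (A : {set cube n}) : Prop :=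
  forall x y : cube n, (forall i, i \in J -> x i = y i) -> (x \in A) = (y \in A).

Lemma card_cube_gt0 (n : nat) : (0 < #|{: cube n}|)%N.
Proof. by apply/card_gt0P; exists [ffun => false]. Qed.

Lemma prob_setT (R : realType) (n : nat) : prob R [set: cube n] = 1.
Proof. by rewrite /prob cardsT divff // pnatr_eq0 -lt0n card_cube_gt0. Qed.

Lemma prob_setC (R : realType) (n : nat) (A : {set cube n}) :
  prob R (~: A) = 1 - prob R A.
Proof.
apply/eqP; rewrite eq_sym subr_eq addrC -(prob_setT R n) /prob -mulrDl -natrD.
by rewrite cardsC cardsT.
Qed.

Lemma depends_onC (n : nat) (J : {set 'I_n}) (A : {set cube n}) :
  depends_on J A -> depends_on J (~: A).
Proof. by move=> h x y xy; rewrite !inE (h x y). Qed.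

(* Exchanging the coordinates outside [J] between the two components of a pair
   is an involution of [cube n * cube n] carrying [(A :&: B) * cube n] to [A * B]. *)
Lemma prob_setI (R : realType) (n : nat) (J J' : {set 'I_n}) (A B : {set cube n}) :
  [disjoint J & J'] -> depends_on J A -> depends_on J' B ->
  prob R (A :&: B) = prob R A * prob R B.
Proof.
move=> dJ hA hB.
pose sw (p : cube n * cube n) : cube n * cube n :=
  ([ffun i => if i \in J then p.1 i else p.2 i],
   [ffun i => if i \in J then p.2 i else p.1 i]).
have swK : involutive sw.
  by move=> [x y]; rewrite /sw /=; congr (_ , _); apply/ffunP => i; rewrite !ffunE /=;
    case: (i \in J).
have e : #|finset.setX (A :&: B) [set: cube n]| = #|finset.setX A B|.
  rewrite -(card_imset _ (inv_inj swK)); apply: eq_card => p.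
  rewrite -{1}(swK p) (mem_imset _ _ (inv_inj swK)) !inE andbT.
  congr andb.
    by apply: hA => i iJ; rewrite ffunE iJ.
  apply: hB => i iJ; rewrite ffunE ifF //; apply/negP => iJ'.
  by move: dJ; rewrite disjoint_subset => /fintype.subsetP /(_ i iJ'); rewrite inE iJ.
move: e; rewrite !cardsX cardsT => e.
have c0 : #|{: cube n}|%:R != 0 :> R by rewrite pnatr_eq0 -lt0n card_cube_gt0.
have eR : #|A :&: B|%:R * #|{: cube n}|%:R = #|A|%:R * #|B|%:R :> R by rewrite -!natrM e.
by rewrite /prob mulrACA -eR; field.
Qed.

Lemma prob_bigcap (R : realType) (n : nat) (I : eqType) (s : seq I) (J : I -> {set 'I_n})
    (A : I -> {set cube n}) : uniq s ->
  (forall i j, i != j -> [disjoint J i & J j]) -> (forall i, depends_on (J i) (A i)) ->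
  prob R (\bigcap_(i <- s) A i) = \prod_(i <- s) prob R (A i).
Proof.
move=> us dJ hA; elim: s us => [|a s IH] /=; first by rewrite !big_nil prob_setT.
case/andP=> aS us; rewrite !big_cons -IH //.
apply: (@prob_setI R n (J a) (\bigcup_(i <- s) J i)) => //.
  elim: s aS {IH us} => [|b s IHs]; first by rewrite big_nil -setI_eq0 finset.setI0.
  rewrite inE negb_or big_cons => /andP[ab aS].
  have := dJ a b ab; have := IHs aS.
  by rewrite -!setI_eq0 finset.setIUr => /eqP -> /eqP ->; rewrite finset.setU0 eqxx.
move=> x y; elim: s {IH us aS} => [|b s IHs]; first by rewrite !big_nil !inE.
rewrite !big_cons => h; rewrite !inE; congr andb.
  by apply: hA => i iJ; apply: h; rewrite inE iJ.
by apply: IHs => i iJ; apply: h; rewrite inE iJ orbT.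
Qed.

Definition flip (I : finType) (i : I) (x : {ffun I -> bool}) : {ffun I -> bool} :=
  [ffun j => (j == i) (+) x j].

Lemma flipK (I : finType) (i : I) : involutive (flip i).
Proof. by move=> x; apply/ffunP => j; rewrite !ffunE addbA addbb. Qed.

Lemma prob_coord (R : realType) (n : nat) (i : 'I_n) (b : bool) :
  prob R [set x : cube n | x i == b] = 1 / 2.
Proof.
have e : prob R (~: [set x : cube n | x i == b]) = prob R [set x : cube n | x i == b].
  rewrite /prob -(card_imset [pred x in [set x : cube n | x i == b]] (inv_inj (flipK i))).
  congr (_%:R / _); apply: eq_card => x.
  rewrite -{2}(flipK i x) (mem_imset _ _ (inv_inj (flipK i))) !inE ffunE eqxx.
  by case: (x i); case: b.
by move: e; rewrite prob_setC; lra.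
Qed.

Lemma depends_on_coord (n : nat) (i : 'I_n) (b : bool) :
  depends_on [set i] [set x : cube n | x i == b].
Proof. by move=> x y h; rewrite !inE h // inE. Qed.

(** * The multiplexed function *)

Section Multiplexer.
Context (n n1 M w : nat).
Notation cell := ('I_M * (bool * bool * bool))%type.
Context (phi : (cell * 'I_w) + ('I_4 * 'I_n1) -> 'I_n) (phi_inj : injective phi).
Context (v : {ffun 'I_M * 'I_4 -> 'I_n1}).
Implicit Types (x : cube n) (b : cube M) (k : cell) (rho : {ffun 'I_4 * 'I_n1 -> bool}).

Definition tribe_set k : {set cube n} :=
  \bigcap_(j : 'I_w) [set x : cube n | x (phi (inl (k, j))) == true].

Definition active x : {set cell} := [set k | x \in tribe_set k].

Definition mux (H : cell -> cube n -> bool) : boolfun n :=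
  [ffun x => (1 < #|active x|)%N || [exists k in active x, H k x]].

Definition cell_var k (l : 'I_4) : 'I_n := phi (inr (l, v (k.1, l))).

(** A cell stores its first three signs; the fourth is forced, so that the four xor to [b k.1]. *)
Definition cell_sign b k (l : 'I_4) : bool :=
  let: (c0, c1, c2) := k.2 in
  nth false [:: c0; c1; c2; c0 (+) c1 (+) c2 (+) b k.1] l.

(** A sign [true] negates the literal, in agreement with the shift [r] in [unate]. *)
Definition cell_and b k x : bool := [forall l, x (cell_var k l) != cell_sign b k l].

Definition hard_fun b : boolfun n := mux (cell_and b).

Definition parities rho : cube M :=
  [ffun t => \big[addb/false]_(l < 4) rho (l, v (t, l))].

Definition agreement b rho : {set 'I_M} := [set t | b t == parities rho t].

Definition consistent b rho : {set cell} :=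
  [set k | [forall l, cell_sign b k l == rho (l, v (k.1, l))]].

(** The unit of distance: an inconsistent cell costs exactly its peak. Peaks of different cells are
    disjoint. *)
Definition peak b k : {set cube n} := [set x | (active x == [set k]) && cell_and b k x].

(** For each parity [rho] dictates the first three signs, leaving one candidate cell; its forced
    fourth sign is right exactly when the parity agrees. *)
Lemma card_consistent b rho : #|consistent b rho| = #|agreement b rho|.
Proof.
pose o (i : nat) : 'I_4 := inord i.
pose g t : cell := (t, (rho (o 0, v (t, o 0)), rho (o 1, v (t, o 1)), rho (o 2, v (t, o 2))))%N.
have gi : injective g by move=> t t' [].
rewrite -(card_imset _ gi); apply: eq_card => k.
have oE (i : nat) (hi : (i < 4)%N) : Ordinal hi = o i by apply: val_inj;
  rewrite /= inordK.
have all4 (P : pred 'I_4) : [forall l, P l] = [&& P (o 0), P (o 1), P (o 2) & P (o 3)]%N.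
  apply/forallP/and4P => [h|[h0 h1 h2 h3]]; first by split; apply: h.
  by case=> [[|[|[|[|m]]]] hm]; rewrite ?oE //; lia.
have pE t : parities rho t = rho (o 0, v (t, o 0)) (+) rho (o 1, v (t, o 1)) (+)
    rho (o 2, v (t, o 2)) (+) rho (o 3, v (t, o 3)).
  rewrite ffunE (eq_bigr (fun l : 'I_4 => rho (o l, v (t, o l)))); last first.
    by move=> l _; rewrite /o inord_val.
  by rewrite !big_ord_recr big_ord0.
apply/idP/imsetP.
  case: k => t [[c0 c1] c2].
  rewrite inE all4 /cell_sign /= !inordK //= => /and4P[/eqP e0 /eqP e1 /eqP e2 /eqP e3].
  exists t; last by rewrite /g -e0 -e1 -e2.
  by rewrite inE pE -e0 -e1 -e2 -e3 addbA addbb addFb.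
move=> [t]; rewrite inE pE => /eqP bt ->.
rewrite inE all4 /cell_sign /= !inordK //= !eqxx /= bt.
by rewrite addbA addbb addFb.
Qed.

Lemma in_active x k : (k \in active x) = [forall j, x (phi (inl (k, j)))].
Proof.
rewrite inE; apply/bigcapP/forallP => h j; first by have := h j isT; rewrite inE eqb_id.
by rewrite inE h.
Qed.

Lemma prob_tribe (R : realType) k : prob R (tribe_set k) = (1 / 2) ^+ w.
Proof.
rewrite /tribe_set (@prob_bigcap _ _ _ _ (fun j =>
    [set phi (inl (k, j))])) ?index_enum_uniq //.
- by under eq_bigr do rewrite prob_coord; rewrite prodr_const card_ord.
- move=> i j ij; rewrite disjoints1 inE; apply: contra ij => /eqP /phi_inj [->] //.
- by move=> j; apply: depends_on_coord.
Qed.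

Lemma depends_on_tribe k :
  depends_on [set phi (inl (k, j)) | j in [set: 'I_w]] (tribe_set k).
Proof.
move=> x y h; apply/bigcapP/bigcapP => hx j _; have := hx j isT; rewrite !inE h //.
  by apply/imsetP; exists j; rewrite ?inE.
by apply/imsetP; exists j; rewrite ?inE.
Qed.

(** The tribe of [k] holds, all others fail and four literals hold: independent events, as [phi]
    keeps their variables disjoint. *)
Lemma prob_peak (R : realType) b k :
  prob R (peak b k) = (1 / 16) * (1 / 2) ^+ w * (1 - (1 / 2) ^+ w) ^+ (#|{: cell}|.-1).
Proof.
pose J (i : cell + 'I_4) : {set 'I_n} := match i with
  | inl k' => [set phi (inl (k', j)) | j in [set: 'I_w]]
  | inr l => [set cell_var k l] end.
pose A (i : cell + 'I_4) : {set cube n} := match i with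
  | inl k' => if k' == k then tribe_set k' else ~: tribe_set k'
  | inr l => [set x : cube n | x (cell_var k l) == ~~ cell_sign b k l] end.
have -> : peak b k = \bigcap_(i : cell + 'I_4) A i.
  apply/setP => x; apply/idP/bigcapP.
    rewrite inE => /andP[/eqP ax /forallP hx] [k'|l] _ /=; last first.
      by rewrite inE; have := hx l; case: (x _); case: cell_sign.
    have : (k' \in active x) = (k' == k) by rewrite ax inE.
    by rewrite inE; case: eqP => // _; rewrite inE => ->.
  move=> h; rewrite inE; apply/andP; split.
    apply/eqP/setP => k'; have := h (inl k') isT; rewrite !inE /=.
    by case: eqP => // _; rewrite inE => /negbTE.
  apply/forallP => l; have := h (inr l) isT; rewrite /= inE => /eqP ->.
  by case: cell_sign.
rewrite (@prob_bigcap _ _ _ _ J) ?index_enum_uniq //.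
- rewrite big_sumType /= (bigD1 k) //= eqxx prob_tribe.
  have -> : \prod_(i | i != k) prob R (if i == k then tribe_set i else ~: tribe_set i) =
      (1 - (1 / 2) ^+ w) ^+ (#|{: cell}|.-1).
    under eq_bigr => i /negbTE -> do rewrite prob_setC prob_tribe.
    rewrite prodr_const; congr (_ ^+ _); rewrite -(cardC1 k); apply: eq_card => i.
    by rewrite !inE.
  under eq_bigr do rewrite prob_coord.
  by rewrite prodr_const card_ord; field.
- case=> [k'|l] [k''|l'] ij.
  + rewrite -setI_eq0; apply/eqP/setP => i; rewrite !inE; apply/negP => /andP[].
    case/imsetP => j _ -> /imsetP[j' _ /phi_inj [e _]]; move: ij; by rewrite e eqxx.
  + rewrite disjoint_sym disjoints1; apply/negP => /imsetP[j _ /phi_inj]; by [].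
  + rewrite disjoints1; apply/negP => /imsetP[j _ /phi_inj]; by [].
  + rewrite disjoints1 inE; apply: contra ij => /eqP /phi_inj [->]; by [].
- case=> [k'|l] /=; last exact: depends_on_coord.
  by case: ifP => _; [|apply: depends_onC]; apply: depends_on_tribe.
Qed.

(** Since [r] vanishes on the tribe variables, moving up only adds active cells: a satisfied active
    cell stays active, and two active cells already force the value 1. *)
Lemma mux_unate (H : cell -> cube n -> bool) (r : cube n) :
  (forall k j, r (phi (inl (k, j))) = false) ->
  (forall k x y, cube_le x y -> H k (cube_xor x r) -> H k (cube_xor y r)) ->
  unate (mux H).
Proof.
move=> r0 Hmon; apply/existsP; exists r; apply/forallP => x; apply/forallP => y.
apply/implyP => xy; apply/implyP; rewrite !ffunE.
have sub : active (cube_xor x r) \subset active (cube_xor y r).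
  apply/fintype.subsetP => k; rewrite !in_active => /forallP h; apply/forallP => j.
  have := h j; rewrite !ffunE r0 !addbF => hj.
  by have /forallP/(_ (phi (inl (k, j)))) := xy; rewrite hj.
case/orP=> [h|/exists_inP[k ka hk]].
  by rewrite (leq_trans h (subset_leq_card sub)).
apply/orP; right; apply/exists_inP; exists k; last exact: Hmon hk.
exact: (fintype.subsetP sub).
Qed.

(** Replacing the functions of the inconsistent cells by 0 gives a function that is unate for the
    extension of [rho] by [false], and changes values on their peaks only. *)
Lemma dist_unate_le (R : realType) b rho :
  dist_to R (hard_fun b) (@unate n) <= \sum_(k in ~: consistent b rho) prob R (peak b k).
Proof.
have [r rl rr] : exists2 r : cube n, forall k j, r (phi (inl (k, j))) = false &
    forall p, r (phi (inr p)) = rho p.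
  exists [ffun i => [exists p, (phi (inr p) == i) && rho p]] => [k j|p]; rewrite ffunE.
    by apply/existsP => -[p /andP[/eqP /phi_inj]].
  apply/existsP/idP => [[p' /andP[/eqP /phi_inj [->]]] //|hp].
  by exists p; rewrite eqxx.
pose H k x := (k \in consistent b rho) && cell_and b k x.
have Hu : unate (mux H).
  apply: (mux_unate rl) => k x y xy /andP[kc /forallP hx]; rewrite /H kc /=.
  apply/forallP => l; have := hx l; rewrite !ffunE rr.
  move: kc; rewrite inE => /forallP/(_ l)/eqP ->.
  have /forallP/(_ (cell_var k l)) := xy.
  by case: (x _); case: (y _); case: (rho _).
have [_ /(_ _ Hu) h] := dist_toP R (hard_fun b) (unate_cst n false).
apply: le_trans h _; rewrite /dist /prob -mulr_suml.
rewrite ler_wpM2r ?invr_ge0 ?ler0n // -natr_sum ler_nat.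
apply: (@leq_trans #|\bigcup_(k in ~: consistent b rho) peak b k|).
  apply: subset_leq_card; apply/fintype.subsetP => x; rewrite !inE !ffunE.
  case: leqP => //= a1 ne.
  have : [exists k in active x, cell_and b k x] && ~~ [exists k in active x, H k x].
    case e1: [exists k in active x, cell_and b k x];
      case e2: [exists k in active x, H k x];
      move: ne; rewrite e1 e2 //= => _.
    by case/exists_inP: e2 => k ka /andP[_ hk]; move/exists_inP: e1 => []; exists k.
  case/andP=> /exists_inP[k ka hk] /exists_inP nH.
  have kc : k \notin consistent b rho.
    by apply/negP => kc; apply: nH; exists k => //; rewrite /H kc.
  apply/bigcupP; exists k; first by rewrite inE.
  rewrite inE hk andbT eq_sym eqEcard cards1 a1 andbT; apply/fintype.subsetP => k'.
  by rewrite inE => /eqP ->.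
elim/big_rec2: _ => [|k y1 y2 _ IH]; first by rewrite cards0.
by rewrite (leq_trans (leq_card_setU _ _).1) // leq_add2l.
Qed.

Lemma active_flip x p : active (flip (phi (inr p)) x) = active x.
Proof.
apply/setP => k; rewrite !in_active; apply: eq_forallb => j; rewrite ffunE.
by case: eqP => // /phi_inj.
Qed.

(* On the peak of an inconsistent cell, [hard_fun b] drops along the flip of
   some variable in which [g] may not drop, so it errs at [x] or at its flip. *)
Lemma dist_unate_ge (R : realType) b (g : boolfun n) : unate g ->
  exists rho, \sum_(k in ~: consistent b rho) prob R (peak b k) <= dist R (hard_fun b) g.
Proof.
case/existsP => r gmon.
pose rho : {ffun 'I_4 * 'I_n1 -> bool} := [ffun p => r (phi (inr p))]; exists rho.
rewrite /dist /prob -mulr_suml ler_wpM2r ?invr_ge0 ?ler0n // -natr_sum ler_nat.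
(* For an inconsistent cell, [l] is a slot whose sign differs from [r]; [ord0] is a dummy choice for
   the consistent ones. *)
have hl k : exists l, (k \in ~: consistent b rho) ==> (cell_sign b k l != r (cell_var k l)).
  case: (boolP [exists l, cell_sign b k l != r (cell_var k l)]) =>
      [/existsP[l hl]|/existsPn h].
    by exists l; rewrite hl implybT.
  exists ord0; apply/implyP; rewrite !inE => /negP[]; apply/forallP => l; rewrite ffunE.
  by have := h l; rewrite negbK.
pose lk k := xchoose (hl k).
have lkP k : k \in ~: consistent b rho -> cell_sign b k (lk k) != r (cell_var k (lk k)).
  exact/implyP/(xchooseP (hl k)).
pose P := [set p : cell * cube n | (p.1 \in ~: consistent b rho) && (p.2 \in peak b p.1)].
have -> : (\sum_(k in ~: consistent b rho) #|peak b k| = #|P|)%N.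
  under eq_bigr do rewrite -sum1_card.
  rewrite pair_big_dep /= -sum1_card; by apply: eq_bigl => p; rewrite [RHS]inE.
pose fl p := flip (cell_var p.1 (lk p.1)) p.2.
(* [e] sends a peak point to an error of [g]. It is injective: the active set recovers the cell, and
   the value of [cell_and] tells a peak point from a flipped one. *)
pose e (p : cell * cube n) := if g p.2 then fl p else p.2.
have ae p : p \in P -> active (e p) = [set p.1].
  rewrite inE => /andP[_]; rewrite inE => /andP[/eqP <- _].
  by rewrite /e; case: ifP => // _; rewrite active_flip.
have hfl p : p \in P -> cell_and b p.1 (fl p) = false.
  rewrite inE => /andP[_]; rewrite inE => /andP[_ /forallP h].
  apply/forallP => /(_ (lk p.1)); have := h (lk p.1); rewrite !ffunE eqxx.
  by case: (p.2 _); case: cell_sign.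
have hp p : p \in P -> cell_and b p.1 p.2.
  by rewrite inE => /andP[_]; rewrite inE => /andP[].
have inj : {in P &, injective e}.
  move=> p q pP qP epq.
  have pq1 : p.1 = q.1.
    by apply/eqP; have := ae p pP; rewrite epq ae // => /setP /(_ p.1);
      rewrite !inE eqxx => ->.
  have h1 := hfl p pP; have h2 := hfl q qP; have h3 := hp p pP; have h4 := hp q qP.
  case: p q pP qP epq pq1 h1 h2 h3 h4 => [k x] [k' y] /= _ _; rewrite /e /=.
  case: (g x); case: (g y) => E K; move: E; rewrite -{}K /fl /=.
  - by move=> /(inv_inj (@flipK _ _)) ->.
  - by move=> -> h1 h2 h3 h4; move: h4; rewrite h1.
  - by move=> -> h1 h2 h3 h4; move: h3; rewrite h2.
  - by move=> ->.
rewrite -(card_in_imset inj); apply: subset_leq_card;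
  apply/fintype.subsetP => z /imsetP[p pP ->].
have muxE x : active x = [set p.1] -> hard_fun b x = cell_and b p.1 x.
  move=> a; rewrite ffunE a cards1 /=; apply/exists_inP/idP => [[k]|h].
    by rewrite inE => /eqP ->.
  by exists p.1; rewrite ?inE.
rewrite inE muxE ?ae // /e; case: ifP => gp; last by rewrite hp // gp.
rewrite hfl //.
(* At the flipped variable the peak point equals [r], so after the shift by [r] the flip goes
   upwards. *)
suff -> : g (fl p) by [].
move: (pP); rewrite inE => /andP[kc pk].
have /forallP/(_ (cube_xor p.2 r)) /forallP /(_ (cube_xor (fl p) r)) := gmon.
rewrite !ffunE.
have xx y : cube_xor (cube_xor y r) r = y.
  by apply/ffunP => i; rewrite !ffunE -addbA addbb addbF.
rewrite !xx gp /= => /implyP -> //.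
apply/forallP => i; rewrite !ffunE; case: eqP => [->|_]; last by rewrite implybb.
have /forallP/(_ (lk p.1)) := hp p pP.
have := lkP p.1 kc.
by case: (p.2 _); case: (r _); case: cell_sign.
Qed.

End Multiplexer.

(** * Acceptance probabilities *)

Definition accept (R : realType) (n : nat) (T : ralg R n) (f : boolfun n) : R :=
  fine (accept_prob T f).

Lemma acceptE (R : realType) (n : nat) (T : ralg R n) (f : boolfun n) :
  accept_prob T f = (accept T f)%:E.
Proof. by rewrite /accept fineK // fin_num_measure //; exact: ralg_measurable. Qed.

Lemma accept_le1 (R : realType) (n : nat) (T : ralg R n) (f : boolfun n) :
  accept T f <= 1.
Proof. by rewrite -lee_fin -acceptE probability_le1 //; exact: ralg_measurable. Qed.

Lemma reject_probE (R : realType) (n : nat) (T : ralg R n) (f : boolfun n) :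
  reject_prob T f = (1 - accept T f)%:E.
Proof.
rewrite EFinB -acceptE /accept_prob -probability_setC; last exact: ralg_measurable.
congr (coin_prob T _); apply/seteqP; split => x /=; first by move=> ->.
by case: run.
Qed.

(** Exchanging the mean with the integral over the coins reduces the comparison to deterministic
    trees. *)
Lemma mean_accept (R : realType) (n : nat) (T : ralg R n) (W : finType)
    (f : W -> boolfun n) :
  ((mean (fun u => accept T (f u)))%:E =
    \int[coin_prob T]_x (mean (fun u => (run (ralg_tree T x) (f u))%:R))%:E)%E.
Proof.
pose acc u := [set x : coin T | run (ralg_tree T x) (f u) = true]%classic.
have runE x u : (run (ralg_tree T x) (f u))%:R = \1_(acc u) x :> R.
  rewrite indicE; case e: (run _ _).
    by rewrite mem_set.
  by rewrite memNset //= /acc /= e.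
have macc u : measurable (acc u) by exact: ralg_measurable.
have mf u : measurable_fun [set: coin T]%classic (EFin \o \1_(acc u) : coin T -> \bar R).
  by apply/measurable_EFinP; exact: measurable_indic.
rewrite (eq_integral (fun x => (#|W|%:R^-1)%:E * \sum_(u : W) (EFin \o \1_(acc u)) x)%E).
  rewrite ge0_integralZl //; last 2 first.
  - exact: emeasurable_sum.
  - by move=> x _; rewrite sume_ge0 // => u _; rewrite lee_fin.
  rewrite ge0_integral_sum //; last by move=> u x _; rewrite lee_fin.
  rewrite /mean mulrC EFinM -sumEFin; congr (_ * _)%E.
  by apply: eq_bigr => u _; rewrite integral_indic // setIT -acceptE.
move=> x _; rewrite /mean mulrC EFinM -sumEFin; congr (_ * _)%E.
by apply: eq_bigr => u _; rewrite runE.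
Qed.

(** * The lower bound *)

Lemma sum_involution_opp (R : realType) (W : finType) (s : W -> W) (G : W -> R) :
  involutive s -> (forall w, G (s w) = - G w) -> \sum_w G w = 0.
Proof.
move=> sK h.
have : \sum_w G w = - \sum_w G w.
  rewrite {1}(reindex_inj (inv_inj sK)) /= -sumrN; apply: eq_bigr => w _; exact: h.
by lra.
Qed.

Lemma fooling_id (R : realType) (M q : nat) : fooling R q (fun b : cube M => b).
Proof.
move=> S /andP[/card_gt0P[t tS] _]; apply: (sum_involution_opp (@flipK _ t)) => b.
rewrite /character !(big_setD1 t tS) /= ffunE eqxx.
rewrite (eq_bigr (fun i => (-1) ^+ b i)); last first.
  by move=> i; rewrite !inE ffunE => /andP[/negbTE -> _].
by case: (b t); rewrite /= ?expr0 ?expr1; ring.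
Qed.

(** Exponential moment bound: 2 to the number of agreements sums to 3^M = 81^m over all [b], and
    each counted [b] contributes at least 2^(3m) = 8^m. *)
Lemma card_mostly_agree (M m : nat) (c : cube M) : M = (4 * m)%N ->
  (#|[set b : cube M | 3 * m <= #|[set t | b t == c t]|]| * 8 ^ m <= 81 ^ m)%N.
Proof.
move=> Mm.
have e : (\sum_(b : cube M) 2 ^ #|[set t | b t == c t]| = 3 ^ M)%N.
  have -> : (3 ^ M = \prod_(t < M) \sum_(a : bool) (if a == c t then 2 else 1))%N.
    rewrite -[X in (3 ^ X)%N]card_ord -prod_nat_const; apply: eq_bigr => t _.
    by rewrite big_bool; case: (c t).
  rewrite bigA_distr_bigA; apply: eq_bigr => b _.
  by rewrite -prod_nat_const big_mkcond; apply: eq_bigr => t _; rewrite inE.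
rewrite -[81%N]/(3 ^ 4)%N -expnM -Mm -e -sum_nat_const.
rewrite [leqRHS](bigID [pred b : cube M | 3 * m <= #|[set t | b t == c t]|]%N) /=.
apply: leq_trans (leq_addr _ _); under eq_bigl do rewrite inE.
by apply: leq_sum => b hb; rewrite -[8%N]/(2 ^ 3)%N -expnM leq_exp2l.
Qed.

(** Flipping the sign at a unique neighbour of [S] changes exactly one parity in [S], hence negates
    the character. *)
Lemma fooling_parities (R : realType) (M n q : nat) (v : {ffun 'I_M * 'I_4 -> 'I_n}) :
  (forall S : {set 'I_M}, (0 < #|S| <= q)%N -> (2 * #|S| < #|nbh v S|)%N) ->
  fooling R q (parities v).
Proof.
move=> hv S hS; have [l [t [tS ht]]] := unique_neighbour (hv S hS).
apply: (sum_involution_opp (@flipK _ (l, v (t, l)))) => rho.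
have e t' : t' \in S ->
    parities v (flip (l, v (t, l)) rho) t' = (t' == t) (+) parities v rho t'.
  move=> t'S; rewrite !ffunE; under eq_bigr do rewrite ffunE.
  rewrite big_split /=; congr addb.
  rewrite (bigD1 l) //= big1 ?addbF; first by rewrite xpair_eqE eqxx /= ht.
  by move=> l' /negbTE ll'; rewrite xpair_eqE ll'.
rewrite /character !(big_setD1 t tS) /= e // eqxx.
rewrite (eq_bigr (fun i => (-1) ^+ parities v rho i)); last first.
  by move=> i; rewrite !inE => /andP[it iS]; rewrite e // (negbTE it).
by case: (parities v rho t); rewrite /= ?expr0 ?expr1; ring.
Qed.

(** The label matters only when a single cell [k] is active, and then only through [b k.1];
    otherwise the index is a dummy. *)
Lemma one_bit_hard_fun (n n1 M w : nat)
    (phi : ('I_M * (bool * bool * bool)) * 'I_w + 'I_4 * 'I_n1 -> 'I_n)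
    (v : {ffun 'I_M * 'I_4 -> 'I_n1}) : (0 < M)%N -> one_bit (hard_fun phi v).
Proof.
move=> M0 x.
case: (boolP [exists k, active phi x == [set k]]) => [/existsP[k /eqP ak]|/existsPn h].
  exists k.1 => b b' bb; rewrite !ffunE ak; congr orb; apply: eq_existsb => k'.
  rewrite inE; case: eqP => //= ->; apply: eq_forallb => l.
  by rewrite /cell_sign bb.
exists (Ordinal M0) => b b' _; rewrite !ffunE;
  case: ltngtP => //= [a0|/esym/eqP/cards1P[k ak]].
  have /cards0_eq -> : #|active phi x| = 0%N by apply/eqP; rewrite -leqn0; exact: a0.
  by apply/exists_inP/exists_inP => -[k]; rewrite inE.
by have := h k; rewrite ak eqxx.
Qed.

Lemma mean_accept_fooling (R : realType) (M n q : nat) (F : cube M -> boolfun n)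
    (W V : finType) (lW : W -> cube M) (lV : V -> cube M) (T : ralg R n) :
  (0 < #|W|)%N -> (0 < #|V|)%N -> one_bit F -> fooling R q lW -> fooling R q lV ->
  makes_at_most T q ->
  mean (fun u => accept T (F (lW u))) = mean (fun u => accept T (F (lV u))).
Proof.
move=> W0 V0 F1 fW fV Tq; apply: EFin_inj; rewrite !mean_accept.
apply: eq_integral => x _; congr EFin.
have /(_ (ralg_tree T x) q finset.set0) := fooling_run W0 V0 F1 fW fV.
rewrite cards0 => /(_ (leqnn _)) h; move: h.
under eq_mean do rewrite character0 mul1r run_uptoE //.
by under [X in _ = X -> _]eq_mean do rewrite character0 mul1r run_uptoE //.
Qed.

(** Union bound over the 2^(4n) vectors [rho]. As 81^2 <= 2^13, the exponent of 2 is 4n + 104n - 48n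
    = 60n, which is at most 64n - 4. *)
Lemma card_agreeable (n : nat) (v : {ffun 'I_(64 * n) * 'I_4 -> 'I_n}) : (0 < n)%N ->
  (16 * #|[set b | [exists rho, 3 * (16 * n) <= #|agreement v b rho|]%N]|
    <= #|{: cube (64 * n)}|)%N.
Proof.
move=> n0; set bad := [set b | _].
have h1 : (#|bad| <= \sum_(rho : {ffun 'I_4 * 'I_n -> bool})
    #|[set b : cube (64 * n) | 3 * (16 * n) <= #|agreement v b rho| ]%N|)%N.
  apply: (@leq_trans #|\bigcup_(rho : {ffun 'I_4 * 'I_n -> bool})
      [set b : cube (64 * n) | 3 * (16 * n) <= #|agreement v b rho| ]%N|).
    apply: subset_leq_card; apply/fintype.subsetP => b; rewrite inE => /existsP[rho h].
    by apply/bigcupP; exists rho; rewrite ?inE.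
  elim/big_rec2: _ => [|k y1 y2 _ IH]; first by rewrite cards0.
  by rewrite (leq_trans (leq_card_setU _ _).1) // leq_add2l.
have h2 : (#|bad| * 8 ^ (16 * n) <= 2 ^ (4 * n) * 81 ^ (16 * n))%N.
  apply: (leq_trans (leq_mul h1 (leqnn _))).
  rewrite big_distrl /=.
  have -> : (2 ^ (4 * n))%N = #|{: {ffun 'I_4 * 'I_n -> bool}}|.
    by rewrite card_ffun card_prod !card_ord card_bool.
  rewrite -sum_nat_const; apply: leq_sum => rho _.
  by apply: card_mostly_agree; lia.
have h3 : (81 ^ (16 * n) <= 2 ^ (104 * n))%N.
  have -> : (16 * n = 2 * (8 * n))%N by lia.
  have -> : (104 * n = 13 * (8 * n))%N by lia.
  by rewrite !(expnM _ _ (8 * n)) leq_exp2r //; lia.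
have h4 : (#|bad| <= 2 ^ (60 * n))%N.
  rewrite -(@leq_pmul2r (2 ^ (48 * n))) ?expn_gt0 // -expnD.
  have -> : (2 ^ (48 * n) = 8 ^ (16 * n))%N by rewrite -[8%N]/(2 ^ 3)%N -expnM;
    congr expn; lia.
  apply: leq_trans h2 _; apply: leq_trans (leq_mul (leqnn _) h3) _.
  by rewrite -expnD leq_exp2l //; lia.
rewrite card_ffun card_ord card_bool; apply: leq_trans (leq_mul (leqnn 16) h4) _.
by rewrite -[16%N]/(2 ^ 4)%N -expnD leq_exp2l //; lia.
Qed.

(* [448 = 7 * 64] and [464 = 8 * 64 - 3 * 16]: the numbers of inconsistent cells
   per variable block when all, resp. three quarters, of the parities agree. *)
Lemma tester_queries_lower_bound (R : realType) (n n1 w q : nat)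
    (T : ralg R n) (eps0 eps1 : R) :
  let peak_mass := (1 / 16) * (1 / 2) ^+ w * (1 - (1 / 2) ^+ w) ^+ (2 ^ w).-1 in
  (0 < n1)%N -> (512 * n1 = 2 ^ w)%N -> (2 ^ w * w + 4 * n1 <= n)%N ->
  (448 * n1)%:R * peak_mass <= eps0 -> eps1 < (464 * n1)%:R * peak_mass ->
  tolerant_tester (@unate n) eps0 eps1 T -> makes_at_most T q ->
  (n1 < 2 ^ 19 * q)%N.
Proof.
move=> mass n0 n1w fits h0 h1 test Tq; rewrite ltnNge; apply/negP => hq.
pose M := (64 * n1)%N.
pose I := ((('I_M * (bool * bool * bool)) * 'I_w) + ('I_4 * 'I_n1))%type.
(* The number of cells is the inverse of the probability of a tribe, so exactly one tribe is
   satisfied with probability close to 1/e. *)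
have cc : #|{: 'I_M * (bool * bool * bool)}| = (2 ^ w)%N.
  by rewrite !card_prod card_ord !card_bool -n1w /M; lia.
have cI : (#|{: I}| <= n)%N.
  by rewrite card_sum card_prod cc [X in (_ + X)%N]card_prod !card_ord.
pose phi (i : I) : 'I_n := widen_ord cI (enum_rank i).
have phi_inj : injective phi.
  by move=> i j /(congr1 val) /= /val_inj /enum_rank_inj.
have [v hv] := expander_exists n0.
pose F := hard_fun phi v.
have mE b k : prob R (peak phi v b k) = mass by rewrite prob_peak // cc.
have sumE b rho : \sum_(k in ~: consistent v b rho) prob R (peak phi v b k) =
    (512 * n1 - #|agreement v b rho|)%:R * mass.
  under eq_bigr do rewrite mE.
  rewrite sumr_const -card_consistent -[LHS]mulr_natl; congr (_%:R * _).
  by have := cardsC (consistent v b rho); rewrite cc n1w; lia.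
have foolv : fooling R q (parities v).
  apply: fooling_parities => S /andP[S0 Sq]; apply: hv => //.
  by apply: leq_trans hq; rewrite leq_mul2l Sq orbT.
have F1 : one_bit F by apply: one_bit_hard_fun; rewrite muln_gt0.
have r0 : (0 < #|{: {ffun 'I_4 * 'I_n1 -> bool}}|)%N.
  by apply/card_gt0P; exists [ffun => false].
(* The mean acceptance is the same for parities and for uniform bits, yet it is at least 2/3 for the
   former and at most 1/3 + 1/16 for the latter. *)
have := mean_accept_fooling r0 (card_cube_gt0 _) F1 foolv (@fooling_id R _ q) Tq.
have yes : 2 / 3 <= mean (fun rho => accept T (F (parities v rho))).
  rewrite /mean ler_pdivlMr ?ltr0n // mulr_natr -sumr_const.
  apply: ler_sum => rho _; rewrite -lee_fin -acceptE; apply: (test _).1.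
  apply: le_trans (dist_unate_le phi_inj v R (parities v rho) rho) _.
  rewrite sumE; have -> : #|agreement v (parities v rho) rho| = M.
    by rewrite -[RHS]card_ord; apply: eq_card => t; rewrite !inE eqxx.
  by apply: le_trans h0; rewrite (_ : 512 * n1 - M = 448 * n1)%N // /M; lia.
pose bad := [set b | [exists rho, 3 * (16 * n1) <= #|agreement v b rho|]%N].
have cb : (16 * #|bad| <= #|{: cube M}|)%N := card_agreeable v n0.
have m0 : 0 <= mass.
  have p1 : (1 / 2) ^+ w <= 1 :> R by rewrite exprn_ile1 //; lra.
  have p0 : 0 <= (1 / 2) ^+ w :> R by rewrite exprn_ge0 //; lra.
  by rewrite /mass !mulr_ge0 ?exprn_ge0 ?subr_ge0 //; lra.
have no : mean (fun b => accept T (F b)) <= 1 / 3 + 1 / 16.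
  rewrite /mean ler_pdivrMr ?ltr0n ?card_cube_gt0 //.
  apply: (@le_trans _ _ (\sum_(b : cube M) (1 / 3 + (b \in bad)%:R))).
    apply: ler_sum => b _; case: (boolP (b \in bad)) => [_|hb].
      by rewrite (le_trans (accept_le1 _ _)) //= lerDr; lra.
    rewrite addr0.
    suff : ((2 / 3)%:E <= reject_prob T (F b))%E by rewrite reject_probE lee_fin; lra.
    apply: (test _).2.
    have [[g ug ->] _] := dist_toP R (F b) (unate_cst n false).
    have [rho] := dist_unate_ge phi_inj v R b ug.
    rewrite sumE; apply: lt_le_trans; apply: lt_le_trans h1 _.
    rewrite ler_wpM2r // ler_nat.
    by move: hb; rewrite inE => /existsPn /(_ rho); rewrite -ltnNge; lia.
  have eb : \sum_(b : cube M) (b \in bad)%:R = #|bad|%:R :> R.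
    rewrite -sum1_card natr_sum [RHS]big_mkcond.
    by apply: eq_bigr => b _; case: (b \in bad).
  rewrite big_split /= eb sumr_const -[X in X + _]mulr_natl.
  by move: cb; rewrite -(ler_nat R) natrM; lra.
by move=> e; move: yes no; rewrite e; lra.
Qed.

(** * Estimates for the tribes and choice of the parameters *)

(** The base is the inverse of 1 + 1/(N - 1), which is at most e^(1/(N - 1)). *)
Lemma tribes_mass_ge (R : realType) (N : nat) : (1 < N)%N ->
  expR (- 1) <= (1 - N%:R^-1) ^+ N.-1 :> R.
Proof.
case: N => [|[|N]] // _; set m : R := N.+1%:R.
have m0 : 0 < m by rewrite ltr0n.
have E : N.+2%:R = m + 1 :> R by rewrite -natr1.
have -> : - 1 = N.+1%:R * (- m^-1) :> R by rewrite mulrN divff // gt_eqF.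
rewrite expRM_natl lerXn2r ?nnegrE ?expR_ge0 //.
  by rewrite E subr_ge0 invf_le1; lra.
have -> : 1 - N.+2%:R^-1 = (1 + m^-1)^-1 :> R.
  by rewrite E; field; lra.
by rewrite expRN lef_pV2 ?posrE ?expR_gt0 ?expR_ge1Dx // addr_gt0 // invr_gt0.
Qed.

Lemma tribes_mass_le (R : realType) (N : nat) : (1 < N)%N ->
  (1 - N%:R^-1) * (1 - N%:R^-1) ^+ N.-1 <= expR (- 1) :> R.
Proof.
move=> N1; rewrite -exprS prednK; last by lia.
have N0 : 0 < N%:R :> R by rewrite ltr0n; lia.
have -> : - 1 = N%:R * (- N%:R^-1) :> R by rewrite mulrN divff // gt_eqF.
rewrite expRM_natl lerXn2r ?nnegrE ?expR_ge0 ?expR_ge1Dx //.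
by rewrite subr_ge0 invf_le1 // ler1n; lia.
Qed.

(** Take the largest [w] satisfying the middle bound; maximality gives n < 2 (w + 2) 2^w. *)
Lemma tribe_width_exists (n : nat) : (10 * 2 ^ 9 <= n)%N ->
  exists w, [/\ 9 <= w, w.+1 * 2 ^ w <= n & n <= 4 * w * 2 ^ w]%N.
Proof.
move=> hn.
have ex : exists w, (w.+1 * 2 ^ w <= n)%N by exists 0%N; apply: leq_trans hn.
have bd w : (w.+1 * 2 ^ w <= n)%N -> (w <= n)%N.
  by apply: leq_trans; rewrite (leq_trans (leqnSn w)) // leq_pmulr // expn_gt0.
case: (ex_maxnP ex bd) => w hw hmax; exists w.
have lt : (n < w.+2 * 2 ^ w.+1)%N.
  by rewrite ltnNge; apply/negP => /hmax; rewrite ltnn.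
have w9 : (9 <= w)%N.
  rewrite leqNgt; apply/negP => w8.
  have : (w.+2 * 2 ^ w.+1 <= 10 * 2 ^ 9)%N by apply: leq_mul => //; rewrite leq_exp2l.
  by move=> h; move: lt; rewrite ltnNge (leq_trans h hn).
split => //; apply: leq_trans (ltnW lt) _.
by rewrite expnS mulnA leq_mul2r; apply/orP; right; clear -w9; lia.
Qed.

Theorem theorem1p4 (R : realType) :
  exists eps0 eps1 : R,
    [/\ 0 < eps0, eps0 < eps1, eps1 < 1 &
      exists C c : R, 0 < C /\
      exists N : nat, forall n : nat, (N <= n)%N ->
      forall (A : ralg R n) (q : nat),
        tolerant_tester (@unate n) eps0 eps1 A ->
        makes_at_most A q ->
        C * (n%:R / (ln n%:R) `^ c) <= q%:R].
Proof.
pose L : R := expR (- 1).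
have L0 : 0 < L := expR_gt0 _.
have L1 : L <= 1 by rewrite /L -[leRHS]expR0 ler_expR; lra.
(* The two distances are [7 / 128 * a] and [29 / 512 * a], with [a] below between
   [L] and [512 / 511 * L]; the constants separate these ranges. *)
exists (707 / 12800 * L), (57 / 1024 * L); split; [lra|lra|lra|].
have ln2 : 0 < ln 2 :> R by rewrite ln_gt0 //; lra.
(* 2^30 = 4 * 512 * 2^19: the factors come from n <= 4 w 2^w, from [n1] = 2^w / 512 and from the
   expansion bound. The power 1 of the logarithm pays for the width [w]. *)
exists (ln 2 / 2 ^+ 30), 1; split; first by rewrite divr_gt0 // exprn_gt0.
exists (10 * 2 ^ 9)%N => n hn T q test Tq.
have {hn} [w [w9 fits big]] := tribe_width_exists hn.
(* This makes the number of cells, 8 * 64 * [n1], equal to 2^w. *)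
pose n1 := (2 ^ (w - 9))%N.
have n0 : (0 < n1)%N by rewrite expn_gt0.
have n1w : (512 * n1 = 2 ^ w)%N.
  by rewrite -[in RHS](subnKC w9) expnD.
set X : R := (2 ^ w)%:R.
have X0 : 512 <= X by rewrite /X ler_nat -n1w leq_pmulr.
have Xp : 0 < X by rewrite (lt_le_trans _ X0) ?ltr0n.
have n1X : n1%:R = X / 512 :> R by rewrite /X -n1w natrM; field.
have hX : (1 / 2) ^+ w = X^-1 :> R by rewrite /X natrX div1r exprVn.
have X1 : (1 < 2 ^ w)%N by rewrite (@ltn_exp2l 2 0) // (leq_trans _ w9).
have a1 := tribes_mass_ge R X1.
have a2 := tribes_mass_le R X1.
rewrite -/X -/L in a1 a2.
set a := (1 - X^-1) ^+ (2 ^ w).-1 in a1 a2.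
have Xi : X^-1 <= 1 / 512.
  by rewrite div1r lef_pV2 ?X0 ?posrE ?Xp ?ltr0n.
have a0 : 0 < a by exact: lt_le_trans a1.
have mass : n1%:R * (1 / 16 * (1 / 2) ^+ w * (1 - (1 / 2) ^+ w) ^+ (2 ^ w).-1) = a / 8192.
  by rewrite hX -/a n1X; field; rewrite gt_eqF.
have qw : (n1 < 2 ^ 19 * q)%N.
  apply: (tester_queries_lower_bound n0 n1w _ _ _ test Tq).
  - rewrite (leq_trans _ fits) // [leqRHS]mulSn [(w * _)%N]mulnC addnC leq_add2r.
    by rewrite -n1w leq_mul2r orbT.
  - rewrite natrM -mulrA mass.
    have aL : (511 / 512) * a <= L.
      by apply: le_trans a2; rewrite ler_wpM2r ?(ltW a0) //; clear -Xi; lra.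
    by clear -aL L0; lra.
  - by rewrite natrM -[ltRHS]mulrA mass; clear -a1 L0; lra.
have nX : n%:R <= 4 * w%:R * X by rewrite /X -!natrM ler_nat.
have lnw : w%:R * ln 2 <= ln n%:R :> R.
  have -> : w%:R * ln 2 = ln X by rewrite /X natrX lnXn // mulr_natl.
  have wn : (2 ^ w <= n)%N by apply: leq_trans fits; rewrite leq_pmull.
  by rewrite ler_ln ?posrE ?ltr0n ?ler_nat ?(leq_trans _ wn) ?expn_gt0.
have w0 : 0 < w%:R :> R by rewrite ltr0n (leq_trans _ w9).
have wl : 0 < w%:R * ln 2 :> R by rewrite mulr_gt0.
have lnn : 0 < ln n%:R :> R by exact: lt_le_trans lnw.
rewrite powRr1 ?(ltW lnn) //.
have qX : X / 2 ^+ 28 <= q%:R.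
  move: qw; rewrite -(ltr_nat R) natrM natrX n1X.
  have -> : 2 ^+ 28 = 512 * 2 ^+ 19 :> R by rewrite (_ : 28 = 9 + 19)%N // exprD; congr *%R; ring.
  move: (2 ^+ 19 : R) (exprn_gt0 19 (ltr0n R 2)) => K K0 qw.
  rewrite ler_pdivrMr ?mulr_gt0 ?K0 ?ltr0n //.
  by clear -qw; lra.
apply: (le_trans _ qX).
rewrite mulrA ler_pdivrMr //.
apply: (@le_trans _ _ (X / 2 ^+ 28 * (w%:R * ln 2))); last first.
  by rewrite ler_wpM2l // divr_ge0 ?exprn_ge0 // ltW.
apply: (@le_trans _ _ (ln 2 / 2 ^+ 30 * (4 * w%:R * X))).
  by rewrite ler_wpM2l // divr_ge0 ?exprn_ge0 // ltW.
rewrite (_ : 30 = 2 + 28)%N // exprD le_eqVlt; apply/orP; left; apply/eqP.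
have : 2 ^+ 28 != 0 :> R by rewrite expf_neq0.
by move: (2 ^+ 28 : R) => K K0; field.
Qed.
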